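(* Let $(\Omega,\Sigma,\mu)$ be a probability space, $N\ge1$, $P=\mu^N$ the product probability on $\Omega^N$, and $q\ge2$ an integer. For all subsets $A_1,\dots,A_q$ of $\Omega^N$, $$\int_{\Omega^N} q^{f(A_1,\dots,A_q,x)}\,dP(x)\le\frac{1}{\prod_{i\le q}P(A_i)} .$$ In particular, for every subset $A$ of $\Omega^N$ and every integer $k\ge 0$, $$P(\{x: f(A,\dots,A,x)\ge k\})\le\frac{1}{q^kP(A)^q}$$ (with $A$ repeated $q$ times).
   Context: For subsets $A_1,\dots,A_q$ of $\Omega^N$ and $x\in\Omega^N$, $$f(A_1,\dots,A_q,x)=\inf\{k : \exists y^1\in A_1,\dots,\exists y^q\in A_q,\ \mathrm{card}\{i\le N: x_i\notin\{y^1_i,\dots,y^q_i\}\}\le k\}.$$ Measurability convention: the sets $A_i$ are measurable, and all sets and functions are treated as if they were measurable (otherwise the integral is an upper integral and the probability an outer probability). $1/0=+\infty$. *)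

(* Defs.v *)
From HB Require Import structures.
From mathcomp Require Import all_boot all_order all_algebra.
From mathcomp Require Import all_classical all_reals all_analysis.
From mathcomp Require Import measurable_realfun.

Set Implicit Arguments.
Unset Strict Implicit.
Unset Printing Implicit Defensive.

Import Order.TTheory GRing.Theory Num.Theory.
Import numFieldNormedType.Exports.

Local Open Scope classical_set_scope.
Local Open Scope ring_scope.
Local Open Scope ereal_scope.

Section product_probability.
Context d (T : measurableType d) (R : realType).

Definition tuple_cons n (p : T * n.-tuple T) : n.+1.-tuple T :=
  [the n.+1.-tuple T of p.1 :: p.2].

Lemma measurable_tuple_cons n :
  measurable_fun [set: T * n.-tuple T] (@tuple_cons n).
Proof. exact: measurable_cons. Qed.

HB.instance Definition _ n :=
  isMeasurableFun.Build _ _ _ _ (@tuple_cons n) (@measurable_tuple_cons n).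

(* The product probability mu^n on the product sigma-algebra of n.-tuple T:
   the image of mu \x mu^(n-1) under the identification of T * T^(n-1) with
   T^n.  It is pinned down by [product_probabilityE]. *)
Fixpoint product_probability (mu : probability T R) (n : nat) :
    probability (n.-tuple T) R :=
  match n with
  | 0%N => dirac [tuple]
  | m.+1 => distribution (mu \x product_probability mu m) (@tuple_cons m)
  end.

Lemma product_probabilityE (mu : probability T R) n (B : 'I_n -> set T) :
  (forall i, measurable (B i)) ->
  product_probability mu n [set x | forall i, B i (tnth x i)] =
  \prod_(i < n) mu (B i).
Proof.
elim: n B => [|n IH] B mB.
  by rewrite big_ord0 /= diracE mem_set// => -[].
rewrite big_ord_recl /= /distribution /pushforward.
rewrite (_ : _ @^-1` _ = B ord0 `*`
    [set x : n.-tuple T | forall i, B (lift ord0 i) (tnth x i)]); last first.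
  apply/seteqP; split=> [[a x] /= H|[a x] /= [Ha Hx] i].
    split; first by have := H ord0; rewrite tnth0.
    by move=> i; have := H (lift ord0 i); rewrite tnthS.
  by have [j|] := unliftP ord0 i => ->; rewrite ?tnthS ?tnth0.
have mE : measurable
    [set x : n.-tuple T | forall i, B (lift ord0 i) (tnth x i)].
  rewrite (_ : [set x : n.-tuple T | _] =
      \bigcap_(i in [set: 'I_n]) ((@tnth n T)^~ i @^-1` B (lift ord0 i))).
    apply: fin_bigcap_measurable => // i _.
    by rewrite -[X in measurable X]setTI; exact: measurable_tnth.
  by apply/seteqP; split=> x /= H i; [move=> _; exact: H|exact: H].
rewrite product_measure1E//; congr (_ * _).
by rewrite -[RHS](IH (fun i => B (lift ord0 i))).
Qed.

End product_probability.

(* The least number of coordinates of x left uncovered by q points y_j in A_j,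
   with value +oo when some A_j is empty. *)
Definition qpoint_dist (R : realType) (T : choiceType) (q N : nat)
    (A : 'I_q -> set (N.-tuple T)) (x : N.-tuple T) : \bar R :=
  ereal_inf [set k%:R%:E | k in [set k : nat |
    exists y : 'I_q -> N.-tuple T, (forall j, A j (y j)) /\
      (#|[pred i : 'I_N | tnth x i \notin [seq tnth (y j) i | j : 'I_q]]|
         <= k)%N]].

(* a ^ e for a real base a > 1 and an extended real exponent e. *)
Definition powRe (R : realType) (a : R) (e : \bar R) : \bar R :=
  match e with
  | r%:E => (a `^ r)%:E
  | +oo => +oo
  | -oo => 0
  end.

(* The upper integral of a nonnegative, not necessarily measurable, function.
   The library's \int of a nonmeasurable nonnegative function is a lower
   integral, a supremum over simple minorants, and would not do here. *)
Definition upper_integral d (T : measurableType d) (R : realType)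
    (P : {measure set T -> \bar R}) (h : T -> \bar R) : \bar R :=
  ereal_inf [set \int[P]_x g x | g in [set g : T -> \bar R |
    measurable_fun [set: T] g /\ forall x, h x <= g x]].

Lemma upper_integralE d (T : measurableType d) (R : realType)
    (P : {measure set T -> \bar R}) (h : T -> \bar R) :
  (forall x, 0 <= h x) -> measurable_fun [set: T] h ->
  upper_integral P h = \int[P]_x h x.
Proof.
move=> h0 mh; apply/eqP; rewrite eq_le; apply/andP; split.
  by apply: ereal_inf_lbound; exists h.
apply: le_ereal_inf_tmp => _ [g [mg hg] <-].
by apply: ge0_le_integral => // x _; exact: le_trans (h0 x) (hg x).
Qed.

(* Main.v *)
(* Induction on N, following Talagrand.  Fixing the first coordinate t of the
   variable, compare A_i with its section at t and with its sections at other
   points w_i: one uncovered coordinate allows every A_i to be cut at a point w_i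
   of our choice, while cutting one A_j at t and the others at w_i costs nothing.
   If s_i is the supremum of P(A_i cut at w_i) and g_j(t) = P(A_j cut at t) / s_j,
   the integral over the other coordinates, multiplied by s_1 ... s_q, is at most
   min(q, 1/g_1(t), ..., 1/g_q(t)), hence at most 1 + q - q g_j(t) for each j; one
   concludes by a^q (1 + q - q a) <= 1.

   Talagrand uses the projection of A_i instead of the sections at w_i, but it
   need not be measurable.  Fixed sections are measurable, and countably many of
   them suffice if the essential supremum replaces the supremum.  To keep the
   majorant of q^f jointly measurable in t and in the remaining coordinates, the
   induction has a parameter in an auxiliary probability space Z, to which t is
   added at each step. *)
Require Import Defs.
From HB Require Import structures.
From mathcomp Require Import all_boot all_order all_algebra.
From mathcomp Require Import all_classical all_reals all_analysis.
From mathcomp Require Import measurable_realfun ring lra.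

Set Implicit Arguments.
Unset Strict Implicit.
Unset Printing Implicit Defensive.

Import Order.TTheory GRing.Theory Num.Theory.

Local Open Scope classical_set_scope.
Local Open Scope ring_scope.
Local Open Scope ereal_scope.

(** * Two elementary real inequalities *)

(** The left side is nonincreasing in q: from q to q + 1 it drops by a^q (1 + q) (1 - a)^2, and it
    is 1 at q = 0. *)
Lemma exprn_mul_chord_le1 (R : realFieldType) (q : nat) (a : R) :
  (0 <= a <= 1)%R -> (a ^+ q * (1 + q%:R - q%:R * a) <= 1)%R.
Proof.
move=> /andP[a0 a1]; elim: q => [|q IH]; first by rewrite expr0 mul0r; lra.
have aq0 : (0 <= a ^+ q)%R by rewrite exprn_ge0.
have q0 : (0 <= q%:R :> R)%R by [].
apply: le_trans IH; rewrite exprS -[q.+1]addn1 natrD mulrAC mulrC.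
apply: ler_wpM2l => //.
set u := q%:R in q0 *.
have : (0 <= (1 + u) * (1 - a) ^+ 2)%R by rewrite mulr_ge0 ?sqr_ge0// addr_ge0.
by rewrite expr2 /= !mulrDl !mulrDr; lra.
Qed.

(* The chord of 1 / g through g = 1 / c and g = 1 lies above min(c, 1 / g) on
   the whole of [0, 1]. *)
Lemma le_chord_inv (R : realFieldType) (c r g : R) :
  (1 <= c -> 0 <= r -> 0 <= g <= 1 -> r <= c -> r * g <= 1 ->
  r + c * g <= 1 + c)%R.
Proof.
move=> c1 r0 /andP[g0 g1] rc rg.
have [r1|r1] := leP r 1%R.
  have : (c * g <= c)%R by rewrite ler_piMr//; lra.
  by lra.
have rp : (0 < r)%R by lra.
(* For r > 1 the claim is multiplied by r: here r c g <= c, and (r - 1) (c - r) >= 0 says r^2 + c <=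
   r + r c. *)
have H1 : (0 <= (r - 1) * (c - r))%R by apply: mulr_ge0; lra.
have H2 : (c * (r * g) <= c)%R by rewrite ler_piMr//; lra.
rewrite -(ler_pM2l rp) mulrDr mulrCA mulrDr mulr1.
by move: H1; rewrite mulrBl mulrBr; lra.
Qed.

(** * Uncovered coordinates and the effect of cutting the first one *)

Section covering.
Context (R : realType) d (T : measurableType d) (q : nat).

Definition uncovered N (y : 'I_q -> N.-tuple T) (x : N.-tuple T) : nat :=
  #|[pred i : 'I_N | tnth x i \notin [seq tnth (y j) i | j : 'I_q]]|.

Lemma qpoint_dist_le N (A : 'I_q -> set (N.-tuple T)) y x :
  (forall j, A j (y j)) -> qpoint_dist R A x <= (uncovered y x)%:R%:E.
Proof.
move=> Ay; apply: ereal_inf_lbound; exists (uncovered y x) => //.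
by exists y; split.
Qed.

(** An infimum over a nonempty set of naturals is attained, so optimal points y_j exist unless some
    A_j is empty. *)
Lemma qpoint_dist_cases N (A : 'I_q -> set (N.-tuple T)) x :
  qpoint_dist R A x = +oo \/ exists y, (forall j, A j (y j)) /\
    qpoint_dist R A x = (uncovered y x)%:R%:E.
Proof.
pose P k := `[< exists y, (forall j, A j (y j)) /\ (uncovered y x <= k)%N >].
have [exP|nP] := pselect (exists k, P k); last first.
  left; rewrite /qpoint_dist (_ : [set _ | _ in _] = set0) ?ereal_inf0//.
  by apply/seteqP; split=> // e [k [y Ay] _]; apply: nP; exists k;
    apply/asboolP; exists y.
right; case: (ex_minnP exP) => m /asboolP[y [Ay ym]] mmin.
exists y; split=> //; apply/eqP; rewrite eq_le qpoint_dist_le//=.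
apply: le_ereal_inf_tmp => _ [k [z [Az zk]] <-].
rewrite lee_fin ler_nat (leq_trans ym)// mmin//.
by apply/asboolP; exists z.
Qed.

Lemma uncovered_cons N (w : 'I_q -> T) (y : 'I_q -> N.-tuple T) t x :
  uncovered (fun j => tuple_cons (w j, y j)) (tuple_cons (t, x)) =
  ((t \notin [seq w j | j : 'I_q]) + uncovered y x)%N.
Proof.
rewrite /uncovered -!sum1_card big_mkcond big_ord_recl [in RHS]big_mkcond/=.
congr (_ + _)%N.
apply: eq_bigr => i _; rewrite !inE tnthS.
rewrite (_ : [seq _ | j : 'I_q] = [seq tnth (y j) i | j : 'I_q])//.
by apply: eq_map => j; rewrite tnthS.
Qed.

Lemma powRe_natM (k l : nat) :
  powRe q%:R (k + l)%:R%:E = (q ^ k)%:R%:E * powRe q%:R l%:R%:E :> \bar R.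
Proof. by rewrite /= -EFinM !powR_mulrn// exprD -natrX. Qed.

(** Optimal points y_j of the sections lift to w_j :: y_j in A_j, and the first coordinate is
    charged only if t is none of the w_j. Arbitrary cuts thus cost at most a factor q, and cuts with
    some w_j = t cost nothing. *)
Lemma powRe_qpoint_dist_cons N (A : 'I_q -> set (N.+1.-tuple T))
    (w : 'I_q -> T) t x : (0 < q)%N ->
  powRe q%:R (qpoint_dist R A (tuple_cons (t, x))) <=
  (q ^ (t \notin [seq w j | j : 'I_q]))%:R%:E *
  powRe q%:R (qpoint_dist R (fun j => [set u | A j (tuple_cons (w j, u))]) x).
Proof.
move=> q0.
have [->/=|[y [Ay ->]]] := qpoint_dist_cases
  (fun j => [set u | A j (tuple_cons (w j, u))]) x.
  by rewrite gt0_muley ?leey// lte_fin ltr0n expn_gt0 q0.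
rewrite -powRe_natM -uncovered_cons.
have := qpoint_dist_le (tuple_cons (t, x))
  (y := fun j => tuple_cons (w j, y j)) Ay.
have [->//|[z [Az ->]]] := qpoint_dist_cases A (tuple_cons (t, x)).
by rewrite /= !lee_fin; apply: ler_powR; rewrite ler1n.
Qed.

End covering.

(** * The inequality in one coordinate, and null sets in products *)

Section integration.
Context d (T : measurableType d) (R : realType).

Lemma probability_integral_le (mu : probability T R) (f : T -> \bar R)
    (c : \bar R) :
  measurable_fun [set: T] f -> (forall w, 0 <= f w) -> 0 <= c ->
  {ae mu, forall w, f w <= c} -> \int[mu]_w f w <= c.
Proof.
move=> mf f0 c0 fc.
rewrite -[leRHS]mule1 -(probability_setT mu) -integral_cst//.
apply: ae_ge0_le_integral => //.
by move: fc; apply: filterS.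
Qed.

(** In its use [h j w] is the measure of A_j cut at w, [s j] bounds it almost everywhere, and [I w]
    is the integral over the other coordinates. The bounds are in product form because [s j] may
    vanish. *)
Lemma coordinate_step (mu : probability T R) (q : nat) (I : T -> \bar R)
    (h : 'I_q -> T -> R) (s : 'I_q -> R) :
  (0 < q)%N ->
  measurable_fun [set: T] I -> (forall w, 0 <= I w) ->
  (forall j, measurable_fun [set: T] (h j)) -> (forall j w, (0 <= h j w)%R) ->
  (forall j, {ae mu, forall w, (h j w <= s j)%R}) ->
  (forall j, (0 <= s j)%R) ->
  {ae mu, forall w, I w * (\prod_j s j)%R%:E <= q%:R%:E} ->
  (forall j, {ae mu, forall w,
     I w * (h j w * \prod_(i | i != j) s i)%R%:E <= 1}) ->
  \int[mu]_w I w * \prod_j \int[mu]_w (h j w)%:E <= 1.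
Proof.
move=> q0 mI I0 mh h0 hs s0 Iq Ih.
have mhE j : measurable_fun [set: T] (fun w => (h j w)%:E).
  exact/measurable_EFinP.
have h0E j w : 0 <= (h j w)%:E by rewrite lee_fin.
have Hs j : \int[mu]_w (h j w)%:E <= (s j)%:E.
  apply: probability_integral_le => //; first by rewrite lee_fin.
  by move: (hs j); apply: filterS => w; rewrite lee_fin.
have H0 j : 0 <= \int[mu]_w (h j w)%:E by apply: integral_ge0.
pose H j := fine (\int[mu]_w (h j w)%:E).
have HE j : \int[mu]_w (h j w)%:E = (H j)%:E.
  by rewrite fineK// ge0_fin_numE//; apply: le_lt_trans (Hs j) (ltry _).
rewrite (eq_bigr _ (fun j _ => HE j)) prodEFin.
have Hge0 j : (0 <= H j)%R by rewrite fine_ge0.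
have Hles j : (H j <= s j)%R by rewrite -lee_fin -HE.
(* If s_k = 0, the k-th integral vanishes and so does the left side, even when the integral of [I]
   is +oo. *)
have [[k sk0]|/forallNP sN0] := pselect (exists i, s i = 0%R).
  have Hk : H k = 0%R.
    by apply/eqP; rewrite eq_le Hge0 andbT -sk0.
  by rewrite (bigD1 k)//= Hk mul0r mule0.
have sp j : (0 < s j)%R by rewrite lt_neqAle s0 andbT eq_sym; exact/eqP.
set S := (\prod_j s j)%R in Iq *.
have Sp : (0 < S)%R by apply: prodr_gt0 => j _.
(* The chord bound with r = I(w) S, g = h_j(w) / s_j and c = q, integrated against the mass 1 of
   [mu]. *)
have bound j : \int[mu]_w I w * S%:E + (q%:R / s j * H j)%:E <= (1 + q%:R)%:E.
  have cj0 : (0 <= q%:R / s j)%R by rewrite divr_ge0.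
  rewrite EFinM -HE -ge0_integralZr ?lee_fin ?(ltW Sp)//.
  rewrite -ge0_integralZl_EFin// -ge0_integralD//; first last.
  - exact: measurable_funeM.
  - by move=> w _; rewrite mule_ge0// lee_fin.
  - exact: emeasurable_funM.
  - by move=> w _; rewrite mule_ge0// lee_fin ltW.
  apply: probability_integral_le => //.
  - by apply: emeasurable_funD;
      [exact: emeasurable_funM|exact: measurable_funeM].
  - by move=> w; rewrite adde_ge0// mule_ge0// lee_fin ltW.
  move: Iq (Ih j) (hs j); apply: filterS3 => w.
  have := I0 w; case: (I w) => [r| |]//; last by rewrite gt0_mulye.
  rewrite -!EFinM -EFinD !lee_fin => r0 rq rh hsj.
  rewrite mulrAC -mulrA; apply: le_chord_inv => //.
  - by rewrite ler1n.
  - by rewrite mulr_ge0// ltW.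
  - by rewrite divr_ge0//= ler_pdivrMr// mul1r.
  - rewrite (_ : _ * _ = r * (h j w * \prod_(i | i != j) s i))%R//.
    rewrite /S (bigD1 j)//=; field; exact: lt0r_neq0.
have j0 : 'I_q := Ordinal q0.
have I_ge0 : 0 <= \int[mu]_w I w by exact: integral_ge0.
have := bound; case: (\int[mu]_w I w) I_ge0 => [x| |]//; last first.
  by move=> _ /(_ j0); rewrite gt0_mulye.
rewrite lee_fin => x0 {}bound.
rewrite -EFinM lee_fin.
pose g j := (H j / s j)%R.
(* For the j with the largest g_j, the product of all the g_i is at most g_j^q. *)
have [/= j _ jmax] := @arg_maxP _ _ _ j0 xpredT g isT.
have := bound j; rewrite -EFinM -EFinD lee_fin mulrAC -mulrA -/(g j) => bj.
have gj : (0 <= g j <= 1)%R by rewrite divr_ge0//= ler_pdivrMr// mul1r.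
apply: le_trans (exprn_mul_chord_le1 q gj).
have -> : (\prod_i H i = S * \prod_i g i)%R.
  rewrite -big_split/=; apply: eq_bigr => i _.
  by rewrite /g mulrCA mulfV ?mulr1// lt0r_neq0.
apply: (@le_trans _ _ (x * S * g j ^+ q)%R).
  rewrite mulrA ler_wpM2l ?mulr_ge0// ?(ltW Sp)//.
  rewrite -[X in (_ ^+ X)%R]card_ord -prodr_const.
  by apply: ler_prod => i _; rewrite jmax// divr_ge0.
rewrite mulrC ler_wpM2l ?exprn_ge0//; first by case/andP: gj.
by rewrite lerBrDr.
Qed.

(** The measure of a null set is the integral of the measures of its sections, so almost all
    sections are null. *)
Lemma ae_prod d' (Z : measurableType d') (nu : probability Z R)
    (mu : probability T R) (Q : Z * T -> Prop) :
  {ae nu \x mu, forall p, Q p} ->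
  {ae nu, forall z, {ae mu, forall w, Q (z, w)}}.
Proof.
move=> [E [mE E0 subE]].
have m0 : {ae nu, forall z, mu (xsection E z) = 0}.
  have := (ae_eq_integral_abs nu measurableT (measurable_fun_xsection mu mE)).1.
  rewrite /=; under eq_integral do rewrite gee0_abs//.
  by move=> /(_ E0); apply: filterS => z /=; apply.
move: m0; apply: filterS => z m0.
exists (xsection E z); split=> //; first exact: measurable_xsection.
by move=> w /= nQ; rewrite /xsection/= inE; exact: subE.
Qed.

End integration.

(** * Approximation of a product of suprema *)

Lemma bernoulli_le (R : realDomainType) (m : nat) (a : R) : (0 <= a <= 1)%R ->
  (1 - m%:R * (1 - a) <= a ^+ m)%R.
Proof.
move=> /andP[a0 a1]; elim: m => [|m IH]; first by rewrite expr0 mul0r subr0.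
rewrite exprS -[m.+1]addn1 natrD.
apply: (@le_trans _ _ (a * (1 - m%:R * (1 - a)))%R); last exact: ler_wpM2l.
rewrite -subr_ge0 (_ : _ - _ = m%:R * (1 - a) ^+ 2)%R; last by ring.
by rewrite mulr_ge0 ?sqr_ge0.
Qed.

Lemma lee_mulXPr (R : realFieldType) (m : nat) (x y : \bar R) : 0 <= x ->
  (forall t, (0 < t < 1)%R -> (t ^+ m)%:E * x <= y) -> x <= y.
Proof.
move=> x0 H; apply/lee_mul01Pr => // r /andP[r0 r1].
(* Bernoulli gives (1 - e)^m >= 1 - m e >= r; dividing by m + 1 rather than m covers m = 0. *)
pose e := ((1 - r) / m.+1%:R)%R.
have e0 : (0 < e)%R by rewrite divr_gt0// subr_gt0.
have er : (e <= 1 - r)%R.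
  by rewrite ler_piMr ?subr_ge0 ?(ltW r1)// invf_le1// ler1n.
have t01 : (0 < 1 - e < 1)%R by apply/andP; split; lra.
apply: le_trans (H _ t01); apply: lee_wpmul2r => //; rewrite lee_fin.
have /(bernoulli_le m) : (0 <= 1 - e <= 1)%R.
  by case/andP: t01 => *; rewrite !ltW.
apply: le_trans.
have : (m%:R * e <= 1 - r)%R.
  rewrite /e mulrCA ler_piMr ?subr_ge0 ?(ltW r1)// ler_pdivrMr// mul1r.
  by rewrite ler_nat.
by lra.
Qed.

(** Each s_i is reached up to a factor t < 1, at a total cost of t^#|Q|; then t tends to 1. A
    multiplicative loss is harmless even for c = +oo. *)
Lemma mule_prod_sup_le (R : realFieldType) (I : finType) (Q : pred I)
    (c b : \bar R) (u : I -> nat -> R) (s : I -> R) :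
  0 <= c -> (forall i, (0 <= s i)%R) -> (forall i n, (0 <= u i n)%R) ->
  (forall i t, (t < s i)%R -> exists n, (t < u i n)%R) ->
  (forall n : {ffun I -> nat}, c * (\prod_(i | Q i) u i (n i))%R%:E <= b) ->
  c * (\prod_(i | Q i) s i)%R%:E <= b.
Proof.
move=> c0 s0 u0 us H; apply: (@lee_mulXPr _ #|Q|).
  by rewrite mule_ge0// lee_fin prodr_ge0.
move=> t /andP[t0 t1].
have /choice[n nP] i : exists n, (t * s i <= u i n)%R.
  have [si0|sip] := leP (s i) 0%R.
    by exists 0%N; apply: le_trans (u0 _ _); rewrite mulr_ge0_le0// ltW.
  have [|n] := us i (t * s i)%R; first by rewrite gtr_pMl.
  by exists n; exact: ltW.
apply: le_trans (H (finfun n)); rewrite muleCA -EFinM lee_wpmul2l// lee_fin.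
rewrite -prodr_const -big_split/=.
by apply: ler_prod => i _; rewrite ffunE nP mulr_ge0// ltW.
Qed.

(** * Essential suprema over countably many points *)

Section exhaustion.
Context d (T : measurableType d) d' (Z : measurableType d') (R : realType).

Lemma measurable_fun_sup_range (f : nat -> Z -> \bar R) :
  (forall n, measurable_fun [set: Z] (f n)) ->
  measurable_fun [set: Z] (fun z => ereal_sup (range (f ^~ z))).
Proof.
move=> mf; have := measurable_fun_esups mf 0%N.
rewrite (_ : (fun x => esups _ _) = (fun z => ereal_sup (range (f ^~ z))))//.
apply/funext => z; rewrite /esups/=; congr ereal_sup.
by apply/seteqP; split => x [n _ <-]; exists n.
Qed.

Lemma measurable_fun_inf_range (f : nat -> Z -> \bar R) :
  (forall n, measurable_fun [set: Z] (f n)) ->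
  measurable_fun [set: Z] (fun z => ereal_inf (range (f ^~ z))).
Proof.
move=> mf; have := measurable_fun_einfs mf 0%N.
rewrite (_ : (fun x => einfs _ _) = (fun z => ereal_inf (range (f ^~ z))))//.
apply/funext => z; rewrite /einfs/=; congr ereal_inf.
by apply/seteqP; split => x [n _ <-]; exists n.
Qed.

(* Exhaustion: w maximizes the integral of the supremum, so that adjoining one
   more point t to w changes the supremum only on a nu-null set. *)
Lemma countable_ess_sup (nu : probability Z R) (mu : probability T R)
    (h : Z * T -> \bar R) :
  measurable_fun [set: Z * T] h -> (forall p, 0 <= h p <= 1) ->
  exists w : nat -> T, {ae nu, forall z, {ae mu, forall t,
    h (z, t) <= ereal_sup (range (fun n => h (z, w n)))}}.
Proof.
move=> mh h01.
pose S (w : nat -> T) z := ereal_sup (range (fun n => h (z, w n))).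
have mh1 t : measurable_fun [set: Z] (fun z => h (z, t)).
  by apply: measurableT_comp => //; exact: pair2_measurable.
have mS w : measurable_fun [set: Z] (S w) by apply: measurable_fun_sup_range.
have hS w z n : h (z, w n) <= S w z by apply: ereal_sup_ubound; exists n.
have S0 w z : 0 <= S w z.
  by apply: le_trans (hS w z 0%N); case/andP: (h01 (z, w 0%N)).
have S1 w z : S w z <= 1.
  by apply: ge_ereal_sup => _ [n _ <-]; case/andP: (h01 (z, w n)).
have Sfin w z : S w z \is a fin_num.
  by rewrite ge0_fin_numE//; exact: le_lt_trans (S1 w z) (ltry _).
pose F w := \int[nu]_z S w z.
have F1 w : F w <= 1 by apply: probability_integral_le => //; exact: aeW.
have F0 w : 0 <= F w by apply: integral_ge0.
pose M := ereal_sup (range F).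
have M1 : M <= 1 by apply: ge_ereal_sup => _ [w _ <-].
have M0 : 0 <= M.
  apply: le_trans (F0 (fun=> point)) _.
  by apply: ereal_sup_ubound; exists (fun=> point).
have Mfin : M \is a fin_num.
  by rewrite ge0_fin_numE//; exact: le_lt_trans M1 (ltry _).
have /choice[ws wsP] k : exists w, M - (k.+1%:R^-1)%:E < F w.
  have k0 : (0 < k.+1%:R^-1 :> R)%R by [].
  by have [_ [w _ <-] ?] := ub_ereal_sup_adherent k0 Mfin; exists w.
(* [W] runs through all points of all the near-maximizing sequences [ws k], hence attains the
   supremum [M]. *)
pose W n := let p := odflt (0, 0)%N (unpickle n) in ws p.1 p.2.
have WsW k z : S (ws k) z <= S W z.
  apply: ge_ereal_sup => _ [n _ <-]; apply: ereal_sup_ubound.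
  by exists (pickle (k, n)) => //; rewrite /W pickleK.
have MW : M <= F W.
  apply/lee_addgt0Pr => e e0.
  have [k] := ltr_add_invr e0; rewrite add0r => ke.
  have : M <= F (ws k) + (k.+1%:R^-1)%:E by rewrite -leeBlDr// ltW.
  move=> /le_trans; apply; apply: leeD; last by rewrite lee_fin ltW.
  by apply: ge0_le_integral.
exists W; apply: (@ae_prod _ _ _ _ _ _ _ (fun p => h p <= S W p.1)).
have mE : measurable [set p | S W p.1 < h p].
  rewrite -[X in measurable X]setTI; apply: measurable_lte => //.
  exact: measurableT_comp.
exists [set p | S W p.1 < h p]; split => //; last first.
  by move=> p /= /negP; rewrite -ltNge.
(* Tonelli with t outermost: it suffices that, for each fixed t, the bad set of z is [nu]-null. *)
have := indic_fubini_tonelli nu mu mE.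
rewrite indic_fubini_tonelli_FE// indic_fubini_tonelli_GE// => HE.
rewrite [LHS]HE; apply: integral0_eq => t _ /=.
pose W' n := if n is n'.+1 then W n' else t.
have WW' z : S W z <= S W' z.
  by apply: ge_ereal_sup => _ [n _ <-]; exact: (hS W' z n.+1).
have Wint w : nu.-integrable [set: Z] (S w).
  apply/integrableP; split => //; under eq_integral do rewrite gee0_abs//.
  exact: le_lt_trans (F1 w) (ltry _).
(* [F W] is already maximal, so adjoining t to [W] cannot raise the integral. *)
have FB : \int[nu]_z (S W' z - S W z) = 0.
  have leM w : F w <= M by apply: ereal_sup_ubound; exists w.
  have -> : \int[nu]_z (S W' z - S W z) = F W' - F W by rewrite integralB.
  have -> : F W' = F W.
    apply/eqP; rewrite eq_le (le_trans (leM W') MW)//=.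
    by apply: ge0_le_integral.
  by rewrite subee// ge0_fin_numE//; exact: le_lt_trans (F1 W) (ltry _).
have : {ae nu, forall z, S W' z - S W z = 0}.
  have := (ae_eq_integral_abs nu measurableT
    (emeasurable_funB (mS W') (mS W))).1.
  rewrite (eq_integral (fun z => S W' z - S W z)); last first.
    by move=> z _; rewrite gee0_abs// sube_ge0 ?Sfin.
  by move=> /(_ FB); apply: filterS => z /=; apply.
move=> SW'; apply: measure_negligible; first exact: measurable_ysection.
apply: negligibleS SW' => z /=; rewrite /ysection/= inE /= => lt0 eq0.
have := hS W' z 0%N; rewrite /W' leNgt => /negP; apply.
by move/eqP: eq0; rewrite sube_eq ?fin_num_adde_defl ?Sfin// add0e => /eqP ->.
Qed.

End exhaustion.

(** * Powers and quotients in the extended reals *)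

Lemma le_powRe (R : realType) (a : R) (e1 e2 : \bar R) : (1 <= a)%R ->
  e1 <= e2 -> powRe a e1 <= powRe a e2.
Proof.
move=> a1; case: e1 e2 => [r1| |] [r2| |]//=; rewrite ?lee_fin ?leey//.
- exact: ler_powR.
- by move=> _; exact: powR_ge0.
Qed.

(** For y = 0 the right side is 1 / 0 = +oo, so the product form loses nothing. *)
Lemma lee_div1 (R : realFieldType) (x y : \bar R) :
  0 <= y -> y \is a fin_num -> x * y <= 1 -> x <= 1 / y.
Proof.
case: y => [y| |]//; rewrite lee_fin le_eqVlt => /predU1P[<- _ _|y0 _ xy].
  by rewrite inve0 mul1e leey.
by rewrite inver gt_eqF// lee_pdivlMr.
Qed.

(** * Measurable majorants with a parameter, by induction on N *)

Section parametrized_majorant.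
Context d (T : measurableType d) (R : realType) (mu : probability T R).
Context (q : nat) (q0 : (0 < q)%N).
Local Notation P := (product_probability mu).

(* A bound (\int G) * \prod P(A_i) <= 1 encodes \int G <= 1 / \prod P(A_i), with
   1 / 0 = +oo, because +oo * 0 = 0 in \bar R. *)
Definition majorant d' (Z : measurableType d') N (nu : probability Z R)
    (A : 'I_q -> set (Z * N.-tuple T)) (G : Z * N.-tuple T -> \bar R) :=
  [/\ measurable_fun [set: Z * N.-tuple T] G,
      forall p, 0 <= G p,
      forall z x,
        powRe q%:R (qpoint_dist R (fun i => xsection (A i) z) x) <= G (z, x) &
      {ae nu, forall z,
        \int[P N]_x G (z, x) * \prod_i P N (xsection (A i) z) <= 1}].

(** The only point of T^0 either lies in all the sections at z, where the distance is 0 and G = 1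
    suffices, or misses one of them, which then has measure 0 and permits G = +oo. *)
Lemma majorant0 d' (Z : measurableType d') (nu : probability Z R)
    (A : 'I_q -> set (Z * 0.-tuple T)) : (forall i, measurable (A i)) ->
  exists G, majorant nu A G.
Proof.
move=> mA; pose E := \bigcap_(i in [set: 'I_q]) A i.
have mE : measurable E by exact: fin_bigcap_measurable.
pose G p : \bar R := if p \in E then 1 else +oo.
have mG : measurable_fun setT G.
  apply: measurable_fun_ifT => //; apply: (measurable_fun_bool true).
  rewrite setTI (_ : _ @^-1` _ = E)//.
  by apply/seteqP; split=> p; [exact: set_mem|exact: mem_set].
exists G; split => //.
- by move=> p; rewrite /G; case: ifP.
- move=> z x; rewrite /G; case: ifPn => [|_]; last exact: leey.
  rewrite inE => Ezx.
  have Azx j : xsection (A j) z x by rewrite /xsection/= mem_set//; exact: Ezx.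
  have := @qpoint_dist_le R _ T q 0 (fun j => xsection (A j) z) (fun=> x) x Azx.
  have -> : uncovered (fun _ : 'I_q => x) x = 0%N.
    by apply: eq_card0; case.
  move=> /(@le_powRe _ q%:R); rewrite ler1n q0 => /(_ isT) /le_trans; apply.
  by rewrite /= powRr0.
- apply: aeW => z; rewrite integral_dirac//; last first.
    by apply: measurableT_comp => //; exact: pair1_measurable.
  rewrite diracT mul1e /G; case: ifPn => [|/negP].
    rewrite inE => Ez; rewrite mul1e big1// => i _ /=.
    by rewrite diracE mem_set//; apply: mem_set; exact: Ez.
  rewrite inE => nE.
  have [i nAi] : exists i, ~ A i (z, [tuple]).
    by apply/existsNP => AE; apply: nE => i _.
  rewrite (bigD1 i)//= diracE memNset ?mul0e ?mule0//.
  by rewrite /xsection/= inE.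
Qed.

Lemma integral_product_probabilityS N (f : N.+1.-tuple T -> \bar R) :
  measurable_fun setT f -> (forall x, 0 <= f x) ->
  \int[P N.+1]_x f x = \int[mu]_t \int[P N]_x f (tuple_cons (t, x)).
Proof.
move=> mf f0; have mcons := @measurable_tuple_cons _ T N.
transitivity (\int[mu \x P N]_p f (tuple_cons p)).
  exact: (ge0_integral_pushforward mcons).
rewrite fubini_tonelli1//; exact: measurableT_comp.
Qed.

Lemma product_probabilityS N (A : set (N.+1.-tuple T)) :
  P N.+1 A = \int[mu]_t P N [set x | A (tuple_cons (t, x))].
Proof.
rewrite /= /distribution /pushforward /= /product_measure1/=.
apply: eq_integral => t _ /=; congr (P N _).
by apply/seteqP; split => x /=; rewrite /xsection/= inE.
Qed.

(** Each choice of cuts gives sets with parameter in Z * T, to which the induction hypothesis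
    applies. The new majorant is the infimum of the countably many resulting ones, weighted by the
    cost of their cuts; [coordinate_step] bounds its integral. *)
Lemma majorantS N :
  (forall d' (Z : measurableType d') (nu : probability Z R)
     (A : 'I_q -> set (Z * N.-tuple T)), (forall i, measurable (A i)) ->
     exists G, majorant nu A G) ->
  forall d' (Z : measurableType d') (nu : probability Z R)
     (A : 'I_q -> set (Z * N.+1.-tuple T)), (forall i, measurable (A i)) ->
     exists G, majorant nu A G.
Proof.
move=> IH d' Z nu A mA.
have m11 : measurable_fun setT (fun p : Z * T * N.-tuple T => p.1.1).
  exact: (measurableT_comp measurable_fst measurable_fst).
have m12 : measurable_fun setT (fun p : Z * T * N.-tuple T => p.1.2).
  exact: (measurableT_comp measurable_snd measurable_fst).
pose phi (p : Z * T * N.-tuple T) := (p.1.1, tuple_cons (p.1.2, p.2)).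
have mphi : measurable_fun [set: Z * T * N.-tuple T] phi.
  apply: measurable_fun_pair => //=.
  apply: (measurableT_comp (@measurable_tuple_cons _ T N)).
  exact: measurable_fun_pair.
pose B i := phi @^-1` A i.
have mB i : measurable (B i).
  by rewrite -[B i]setTI; exact: mphi.
pose h i (p : Z * T) := P N (xsection (B i) p).
have mh i : measurable_fun setT (h i) by exact: measurable_fun_xsection.
have h01 i p : 0 <= h i p <= 1.
  by rewrite measure_ge0 probability_le1//; exact: measurable_xsection.
have /choice[w wP] i := countable_ess_sup nu mu (mh i) (h01 i).
(* A key (n, o) prescribes the cuts: A_i at the point of index n i of w i, except
   that, for o = Some j, A_j is cut at t. *)
pose K := ({ffun 'I_q -> nat} * option 'I_q)%type.
pose pt (k : K) t i := if k.2 == Some i then t else w i (k.1 i).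
have mpt k i : measurable_fun setT (pt k ^~ i).
  by rewrite /pt; case: eqP => _.
pose C k i := [set p | B i ((p.1.1, pt k p.1.2 i), p.2)].
have mC k i : measurable (C k i).
  rewrite -[C k i]setTI; apply: (_ : measurable_fun setT
    (fun p : Z * T * N.-tuple T => ((p.1.1, pt k p.1.2 i), p.2))) => //.
  apply: measurable_fun_pair => //=.
  apply: measurable_fun_pair => //=.
  exact: (measurableT_comp (mpt k i)).
have /choice[G GP] k := IH _ (Z * T)%type (nu \x mu) (C k) (mC k).
(* The cost is 1 when some A_j is cut at t, which covers the first coordinate, and q otherwise. *)
pose c (k : K) := (q ^ (k.2 == None))%N.
(* An enumeration of [K], so that the infimum is over a sequence and stays measurable; numbers
   coding no key get a default one. *)
pose key m : K := odflt ([ffun=> 0%N], None) (unpickle m).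
have keyP k : exists m, key m = k by exists (pickle k); rewrite /key pickleK.
pose G0 p := ereal_inf (range (fun m => (c (key m))%:R%:E * G (key m) p)).
have mG k : measurable_fun setT (G k) by case: (GP k).
have Gge0 k p : 0 <= G k p by case: (GP k).
have G00 p : 0 <= G0 p.
  by apply: le_ereal_inf_tmp => _ [m _ <-]; rewrite mule_ge0// lee_fin.
have G0le k p : G0 p <= (c k)%:R%:E * G k p.
  by have [m <-] := keyP k; apply: ereal_inf_lbound; exists m.
have mG0 : measurable_fun setT G0.
  by apply: measurable_fun_inf_range => m; exact: measurable_funeM.
(* The inverse of [phi]: the head of the tuple moves into the parameter. *)
pose psi (p : Z * N.+1.-tuple T) := ((p.1, thead p.2), [tuple of behead p.2]).
have mpsi : measurable_fun setT psi.
  apply: measurable_fun_pair => /=.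
    apply: measurable_fun_pair => //=.
    exact: (measurableT_comp (measurable_tnth ord0) measurable_snd).
  exact: (measurableT_comp (@measurable_behead _ T N) measurable_snd).
have psicons z t x : psi (z, tuple_cons (t, x)) = ((z, t), x).
  by rewrite /psi /= theadE; congr (_, _); apply/val_inj.
exists (G0 \o psi); split.
- exact: measurableT_comp.
- by move=> p; exact: G00.
- move=> z y; rewrite [(_ \o _) _]/=.
  rewrite (_ : y = tuple_cons (thead y, [tuple of behead y]));
    last exact: tuple_eta.
  move: (thead y) [tuple of behead y] => t x; rewrite psicons.
  apply: le_ereal_inf_tmp => _ [m _ <-]; set k := key m.
  apply: le_trans (powRe_qpoint_dist_cons R _ (pt k t) _ _ q0) _.
  apply: lee_pmul; rewrite ?lee_fin//.
  + by case: (qpoint_dist _ _ _) => [r| |]//=; rewrite lee_fin powR_ge0.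
  + rewrite ler_nat leq_pexp2l// /c /k.
    case: (key m) @k => n [j|] k /=; last by case: (_ \notin _).
    rewrite (_ : t \in _)//; apply/mapP; exists j; rewrite ?mem_enum//.
    by rewrite /pt eqxx.
  + have [_ _ + _] := GP k; move=> /(_ (z, t) x).
    rewrite (_ : (fun i => xsection (C k i) (z, t)) = (fun j =>
      [set u | xsection (A j) z (tuple_cons (pt k t j, u))]))//.
have hC k i p : P N (xsection (C k i) p) = h i (p.1, pt k p.2 i).
  by rewrite /h; congr (P N _).
(* Countably many keys share one null set in Z * T, which is then sliced at z. *)
have key_bound : {ae nu, forall z, {ae mu, forall t, forall m,
    \int[P N]_x G (key m) ((z, t), x) *
    \prod_i h i (z, pt (key m) t i) <= 1}}.
  apply: (@ae_prod _ _ _ _ _ _ _ (fun p => forall m,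
    \int[P N]_x G (key m) (p, x) *
    \prod_i h i (p.1, pt (key m) p.2 i) <= 1)).
  apply: ae_foralln => m; have [_ _ _] := GP (key m).
  by apply: filterS => p; under eq_bigr do rewrite hC.
have sup_bound : {ae nu, forall z, forall i, {ae mu, forall t,
    h i (z, t) <= ereal_sup (range (fun n => h i (z, w i n)))}}.
  exact: filter_forall.
move: key_bound sup_bound; apply: filterS2 => z key_bound sup_bound.
pose hr i t := fine (h i (z, t)).
have hfin i t : h i (z, t) \is a fin_num.
  have /andP[h0 h1] := h01 i (z, t).
  by rewrite ge0_fin_numE//; exact: le_lt_trans h1 (ltry _).
have hrE i t : h i (z, t) = (hr i t)%:E by rewrite fineK.
have hr0 i t : (0 <= hr i t)%R.
  by rewrite -lee_fin -hrE; case/andP: (h01 i (z, t)).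
pose s i := fine (ereal_sup (range (fun n => h i (z, w i n)))).
have sup0 i : 0 <= ereal_sup (range (fun n => h i (z, w i n))).
  have /andP[h0 _] := h01 i (z, w i 0%N).
  by apply: le_trans h0 _; apply: ereal_sup_ubound; exists 0%N.
have sE i : ereal_sup (range (fun n => h i (z, w i n))) = (s i)%:E.
  rewrite fineK// ge0_fin_numE//; apply: (@le_lt_trans _ _ 1); last exact: ltry.
  by apply: ge_ereal_sup => _ [n _ <-]; case/andP: (h01 i (z, w i n)).
have s0 i : (0 <= s i)%R by rewrite fine_ge0.
have s_approx i e : (e < s i)%R -> exists n, (e < hr i (w i n))%R.
  rewrite -lte_fin -sE => /ereal_sup_gt[_ [n _ <-]] en.
  by exists n; rewrite -lte_fin -hrE.
pose I t := \int[P N]_x G0 ((z, t), x).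
have I0 t : 0 <= I t by exact: integral_ge0.
have mI : measurable_fun setT I.
  apply: (measurable_fun_fubini_tonelli_F (m2 := P N)
    (fun p => G0 ((z, p.1), p.2))) => //.
  apply: (measurableT_comp mG0); apply: measurable_fun_pair => //.
  exact: measurable_fun_pair.
(* Integrating [G0 <= c k * G k] over x and inserting the bound for the key k. *)
have I_key : {ae mu, forall t, forall k,
    I t * (\prod_i hr i (pt k t i))%R%:E <= (c k)%:R%:E}.
  move: key_bound; apply: filterS => t tP k; have [m <-] := keyP k.
  rewrite -prodEFin -[leRHS]mule1.
  apply: le_trans (lee_wpmul2l _ (tP m)); last by rewrite lee_fin.
  rewrite muleA; under [X in _ <= _ * X]eq_bigr do rewrite hrE.
  apply: lee_wpmul2r; first by rewrite prodEFin lee_fin prodr_ge0.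
  have mGz : measurable_fun setT (fun x => G (key m) ((z, t), x)).
    by apply: (measurableT_comp (mG _)); exact: pair1_measurable.
  rewrite -ge0_integralZl_EFin//; apply: ge0_le_integral => //.
  - by apply: (measurableT_comp mG0); exact: pair1_measurable.
  - exact: measurable_funeM.
have mG0z : measurable_fun setT (fun y => G0 (psi (z, y))).
  apply: (measurableT_comp mG0); apply: (measurableT_comp mpsi).
  exact: pair1_measurable.
have -> : \int[P N.+1]_y (G0 \o psi) (z, y) = \int[mu]_t I t.
  transitivity (\int[mu]_t \int[P N]_x G0 (psi (z, tuple_cons (t, x)))).
    exact: (integral_product_probabilityS mG0z (fun y => G00 (psi (z, y)))).
  by apply: eq_integral => t _; apply: eq_integral => x _; rewrite psicons.
have -> : \prod_i P N.+1 (xsection (A i) z) = \prod_i \int[mu]_t (hr i t)%:E.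
  apply: eq_bigr => i _; rewrite product_probabilityS.
  by apply: eq_integral => t _; rewrite -hrE; congr (P N _).
apply: (coordinate_step (s := s)) => //.
- move=> i; apply: (measurableT_comp (fine_measurable measurableT)).
  by apply: (measurableT_comp (mh i)); exact: pair1_measurable.
- move=> i; move: (sup_bound i); apply: filterS => t.
  by rewrite sE hrE lee_fin.
(* Keys (n, None): all sets are cut at points of the sequences, and each factor is passed to its
   supremum. *)
- move: I_key; apply: filterS => t It.
  apply: mule_prod_sup_le (I0 t) s0 _ s_approx _; first by move=> *; exact: hr0.
  by move=> n; have := It (n, None); rewrite /c /= expn1.
(* Keys (n, Some j): the factor of A_j stays at t, and only the others are passed to their
   suprema. *)
- move=> j; move: I_key; apply: filterS => t It; rewrite EFinM muleA.
  apply: mule_prod_sup_le s0 _ s_approx _; first by rewrite mule_ge0 ?lee_fin.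
    by move=> *; exact: hr0.
  move=> n; have := It (n, Some j); rewrite /c /= expn0 (bigD1 j)//=.
  rewrite /pt /= eqxx EFinM muleA; under eq_bigr => i ij.
    rewrite (_ : (Some j == Some i) = false); last first.
      by apply/eqP => -[/esym/eqP]; exact/negP.
    over.
  by [].
Qed.

Lemma majorant_ex N d' (Z : measurableType d') (nu : probability Z R)
    (A : 'I_q -> set (Z * N.-tuple T)) : (forall i, measurable (A i)) ->
  exists G, majorant nu A G.
Proof.
elim: N d' Z nu A => [|n IH] d' Z nu A; first exact: majorant0.
exact: majorantS IH _ _ _ _.
Qed.

(** The parameter is removed by taking a one-point space with its Dirac mass, where almost
    everywhere means at [tt]. *)
Lemma qpoint_majorant N (A : 'I_q -> set (N.-tuple T)) :
  (forall i, measurable (A i)) ->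
  exists G : N.-tuple T -> \bar R,
  [/\ measurable_fun [set: N.-tuple T] G, forall x, 0 <= G x,
      forall x, powRe q%:R (qpoint_dist R A x) <= G x &
      \int[P N]_x G x * \prod_i P N (A i) <= 1].
Proof.
move=> mA; pose A' i : set (unit * N.-tuple T) := snd @^-1` A i.
have mA' i : measurable (A' i).
  by rewrite -[A' i]setTI; exact: measurable_snd.
have A'E i : xsection (A' i) tt = A i.
  by apply/seteqP; split => x; rewrite /xsection/= inE.
have [G [mG G0 dG [E [mE E0 subE]]]] := majorant_ex (\d_tt) mA'.
exists (fun x => G (tt, x)); split => //.
- by apply: (measurableT_comp mG); exact: pair1_measurable.
- move=> x; have := dG tt x; rewrite (_ : (fun i => xsection (A' i) tt) = A)//.
  exact/funext.
- rewrite leNgt; apply/negP => lt1.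
  have : E tt.
    apply: subE => /=; under eq_bigr do rewrite A'E.
    by apply/negP; rewrite -ltNge.
  move=> Ett; move: E0; rewrite /= diracE mem_set// => /eqP.
  by rewrite onee_eq0.
Qed.

End parametrized_majorant.

(** * The integral bound and, by Markov's inequality, the tail bound *)

Theorem theorem3p1p1 (R : realType) (d : measure_display)
    (T : measurableType d) (mu : probability T R) (N q : nat)
    (hN : (1 <= N)%N) (hq : (2 <= q)%N) :
  let P := product_probability mu N in
  (forall A : 'I_q -> set (N.-tuple T), (forall i, measurable (A i)) ->
     upper_integral P (fun x => powRe q%:R (qpoint_dist R A x))
       <= 1 / \prod_(i < q) P (A i)) /\
  (forall (A : set (N.-tuple T)) (k : nat), measurable A ->
     mu_ext P [set x | k%:R%:E <= qpoint_dist R (fun _ : 'I_q => A) x]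
       <= 1 / (q%:R%:E ^+ k * P A ^+ q)).
Proof.
move=> P; have q0 : (0 < q)%N by exact: leq_trans hq.
have Pfin A : measurable A -> P A \is a fin_num by exact: fin_num_measure.
split=> [A mA|A k mA].
  have [G [mG G0 dG GA]] := qpoint_majorant mu q0 mA.
  apply: lee_div1.
  - exact: prode_ge0.
  - by apply: prode_fin_num => i _; exact: Pfin.
  apply: le_trans GA; apply: lee_wpmul2r; first exact: prode_ge0.
  by apply: ereal_inf_lbound; exists G.
have [G [mG G0 dG GA]] := qpoint_majorant mu q0 (fun=> mA).
have mE : measurable [set x | q%:R%:E ^+ k <= G x].
  by rewrite -[X in measurable X]setTI; exact: emeasurable_fun_c_infty.
apply: lee_div1.
- by rewrite mule_ge0 ?expe_ge0// lee_fin.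
- by rewrite fin_numM// fin_numX// Pfin.
have -> : P A ^+ q = \prod_(i < q) P A.
  elim: (q) => [|n IH]; first by rewrite big_ord0 expe0.
  by rewrite big_ord_recl -IH expeS.
rewrite muleA; apply: le_trans GA; apply: lee_wpmul2r; first exact: prode_ge0.
(* The possibly nonmeasurable event lies in the measurable set where G >= q^k, to which Markov's
   inequality applies. *)
apply: (@le_trans _ _ (P [set x | q%:R%:E ^+ k <= G x] * q%:R%:E ^+ k)).
  apply: lee_wpmul2r; first by rewrite expe_ge0// lee_fin.
  rewrite -(measurable_mu_extE P mE); apply: le_mu_ext => x /= kx.
  apply: le_trans (dG x).
  have q1 : (1 <= q%:R :> R)%R by rewrite ler1n.
  apply: le_trans (le_powRe q1 kx).
  by rewrite /= powR_mulrn// EFin_expe.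
rewrite muleC -EFin_expe.
have qk0 : (0 < q%:R ^+ k :> R)%R by rewrite exprn_gt0// ltr0n.
have := le_integral_abse P measurableT mG qk0; rewrite setTI.
under eq_set do rewrite gee0_abs//.
by under eq_integral do rewrite gee0_abs//.
Qed.
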